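(* Let $(\Sigma,\mathrm{ar})$ be a non-trivial mixed binding signature. Then the canonical injection $T_\Sigma^\infty/{\approx_\alpha}\hookrightarrow (T_\Sigma/{\approx_\alpha})^\infty$ is an isomorphism (bijection) if and only if the set of variables $\mathcal{V}$ is uncountable.
   Context: Fix a set $\mathcal{V}$ of variables; permutations of $\mathcal{V}$ generated by transpositions act on terms. A mixed binding signature (MBS) is a pair $(\Sigma,\mathrm{ar})$ with $\Sigma$ an at most countable set of constructors and $\mathrm{ar}:\Sigma\to(\mathbb{N}\times\{0,1\})^*$; for $\mathrm{ar}(c)=((n_1,b_1),\dots,(n_k,b_k))$ argument $i$ binds $n_i$ variables and is inductive ($b_i=0$) or coinductive ($b_i=1$). Raw finite terms $T_\Sigma$: finite trees built from variables $x\in\mathcal{V}$ and nodes $c(\bar x_1.t_1,\dots,\bar x_k.t_k)$ with $\bar x_i\in\mathcal{V}^{n_i}$ (i.e. $\mu Z.T_\Sigma(Z,Z)$ for the term functor $T_\Sigma(X,Y)=\mathcal{V}+\coprod_c\prod_i\mathcal{V}^{n_i}\times\pi_{b_i}(X,Y)$, $\pi_0(X,Y)=X,\pi_1(X,Y)=Y$). Raw mixed terms $T_\Sigma^\infty=\nu Y.\mu X.T_\Sigma(X,Y)$ in $\mathbf{Set}$: possibly infinite such trees in which every infinite branch passes through infinitely many coinductive argument positions. Permutation action: $\sigma\cdot x=\sigma(x)$, $\sigma\cdot c(\bar x_1.t_1,\dots)=c(\sigma(\bar x_1).\sigma\cdot t_1,\dots)$. $\alpha$-equivalence on finite terms (including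 finite terms using an extra constant $*$, with $*\approx_\alpha *$): $x\approx_\alpha x$, and $c(\bar x_1.t_1,\dots,\bar x_k.t_k)\approx_\alpha c(\bar y_1.u_1,\dots,\bar y_k.u_k)$ whenever for each $i$, $(\bar x_i\,\bar z_i)\cdot t_i\approx_\alpha(\bar y_i\,\bar z_i)\cdot u_i$ for fresh $\bar z_i$. Truncation: $[t]_0=*$, $[x]_{n+1}=x$, $[c(\bar x_1.t_1,\dots,\bar x_k.t_k)]_{n+1}=c(\bar x_1.[t_1]_{n+1-b_1},\dots,\bar x_k.[t_k]_{n+1-b_k})$. Mixed terms $t,u$ are $\alpha$-equivalent iff $[t]_n\approx_\alpha[u]_n$ for all $n$; $T_\Sigma^\infty/{\approx_\alpha}$ is the quotient. On $T_\Sigma/{\approx_\alpha}$ define the metric $d_\alpha(t,u)=\inf\{2^{-n}:[t]_n\approx_\alpha[u]_n\}$, and let $(T_\Sigma/{\approx_\alpha})^\infty$ be its Cauchy completion. The canonical injection sends the class of a mixed term $t$ to the limit of the classes of finite terms converging to $t$ in the Arnold–Nivat metric $d(t,u)=\inf\{2^{-n}:[t]_n=[u]_n\}$. The MBS is non-trivial if there are constructors $\ell,n,g\in\Sigma$ with: $\ell$ having a binding argument ($n_i\geq1$ for some $i$); $n$ having at least two arguments; $g$ having a coinductive argument ($b_i=1$ for some $i$). *)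

(* Defs.v *)
From HB Require Import structures.
From Stdlib Require Eqdep_dec.
From mathcomp Require Import all_boot all_order all_algebra.
From mathcomp Require Import all_classical all_reals all_analysis.

Set Implicit Arguments.
Unset Strict Implicit.
Unset Printing Implicit Defensive.

Import Order.TTheory GRing.Theory Num.Theory.
Import numFieldNormedType.Exports.

Local Open Scope classical_set_scope.
Local Open Scope ring_scope.

(* The flag of an argument is [false] for inductive, [true] for coinductive. *)
Record mbs := Mbs {
  constructor :> countType;
  ar : constructor -> seq (nat * bool) }.

Section Signature.
Variable S : mbs.
Implicit Type c : S.

Definition nargs c : nat := size (ar c).
Definition binds c (i : 'I_(nargs c)) : nat := (tnth (in_tuple (ar c)) i).1.
Definition coind c (i : 'I_(nargs c)) : bool := (tnth (in_tuple (ar c)) i).2.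

Definition nontrivial_mbs : Prop :=
  [/\ exists (l : S) (i : 'I_(nargs l)), (1 <= binds i)%N,
      exists n : S, (2 <= nargs n)%N
    & exists (g : S) (i : 'I_(nargs g)), coind i].

End Signature.

Section Terms.
Variables (V : choiceType) (S : mbs).

(* Finite terms with extra constants taken in [E]: [term void] is the set of
   raw finite terms, [term unit] has the single extra constant [star]. *)
Inductive term (E : Type) : Type :=
| Cst of E
| Var of V
| Node (c : S) (xs : forall i : 'I_(nargs c), (binds i).-tuple V)
       (ts : 'I_(nargs c) -> term E).
Arguments Var {E} x.
Arguments Node {E c} xs ts.

Definition star : term unit := Cst tt.

Definition transp (x z : V) : V -> V :=
  fun v => if v == x then z else if v == z then x else v.

(* The product (x_1 z_1) o ... o (x_n z_n). *)
Definition transps n (xs zs : n.-tuple V) : V -> V :=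
  fun v => foldr (fun p => transp p.1 p.2) v (zip xs zs).

Fixpoint rename E (s : V -> V) (t : term E) : term E :=
  match t with
  | Cst e => Cst e
  | Var x => Var (s x)
  | Node c xs ts =>
      Node (fun i => map_tuple s (xs i)) (fun i => rename s (ts i))
  end.

(* [z] occurs in [t], free, bound or binding. *)
Fixpoint occurs E (z : V) (t : term E) : bool :=
  match t with
  | Cst _ => false
  | Var x => z == x
  | Node c xs ts => [exists i, (z \in xs i) || occurs z (ts i)]
  end.

Definition fresh E n (zs xs ys : n.-tuple V) (t u : term E) : Prop :=
  uniq zs /\
  forall z, z \in zs ->
    [/\ z \notin xs, z \notin ys, ~~ occurs z t & ~~ occurs z u].

Inductive alpha (E : Type) : term E -> term E -> Prop :=
| alpha_cst e : alpha (Cst e) (Cst e)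
| alpha_var x : alpha (Var x) (Var x)
| alpha_node (c : S) (xs ys zs : forall i : 'I_(nargs c), (binds i).-tuple V)
    (ts us : 'I_(nargs c) -> term E) :
    (forall i, fresh (zs i) (xs i) (ys i) (ts i) (us i)) ->
    (forall i, alpha (rename (transps (xs i) (zs i)) (ts i))
                     (rename (transps (ys i) (zs i)) (us i))) ->
    alpha (Node xs ts) (Node ys us).

Fixpoint trunc (n : nat) (t : term void) : term unit :=
  match n, t with
  | 0, _ => star
  | _.+1, Cst e => match e with end
  | _.+1, Var x => Var x
  | _.+1, Node c xs ts => Node xs (fun i => trunc (n - coind i) (ts i))
  end.

CoInductive tree : Type :=
| TVar of V
| TNode (c : S) (xs : forall i : 'I_(nargs c), (binds i).-tuple V)
        (ts : 'I_(nargs c) -> tree).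
Arguments TNode {c} xs ts.

Inductive child : bool -> tree -> tree -> Prop :=
| Child (c : S) (xs : forall i : 'I_(nargs c), (binds i).-tuple V)
    (ts : 'I_(nargs c) -> tree) (i : 'I_(nargs c)) :
    child (coind i) (ts i) (TNode xs ts).

(* Every infinite branch, with subtrees [u k] and argument flags [b k], crosses
   infinitely many coinductive positions. *)
Definition mixed (t : tree) : Prop :=
  forall (u : nat -> tree) (b : nat -> bool),
    u 0 = t -> (forall k, child (b k) (u k.+1) (u k)) ->
    forall n, exists2 k, (n <= k)%N & b k.

(* Bisimilar trees need not be equal in Rocq; this is harmless, because mixed
   terms are only ever compared through their truncations, which are finite. *)
Record mterm := MTerm { mtree :> tree; mtermP : mixed mtree }.

(* The graph of truncation. It is not structurally recursive: the index does
   not decrease at inductive arguments, and [tree] is coinductive. *)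
Inductive truncates : nat -> tree -> term unit -> Prop :=
| truncates_0 t : truncates 0 t star
| truncates_var n x : truncates n.+1 (TVar x) (Var x)
| truncates_node n (c : S)
    (xs : forall i : 'I_(nargs c), (binds i).-tuple V)
    (ts : 'I_(nargs c) -> tree) (us : 'I_(nargs c) -> term unit) :
    (forall i, truncates (n.+1 - coind i) (ts i) (us i)) ->
    truncates n.+1 (TNode xs ts) (Node xs us).

Lemma truncates_uniq n t s s' : truncates n t s -> truncates n t s' -> s = s'.
Proof.
move=> h; elim: h s' => {n t s}
  [t|n x|n c xs ts us _ IH] s' h; inversion h => //; subst.
have e c' (P : constructor S -> Type) (p q : P c') :
    existT P c' p = existT P c' q -> p = q.
  apply: Eqdep_dec.inj_pair2_eq_dec => u v.
  by case: (eqVneq u v) => [|/eqP]; [left | right].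
repeat match goal with h : existT _ _ _ = _ |- _ =>
  apply e in h; subst end.
by congr Node; apply/funext => i; apply: IH.
Qed.

Lemma truncates_total (t : tree) :
  mixed t -> forall n, exists s, truncates n t s.
Proof.
move=> mt n; apply: contrapT => bad.
pose Bad := {p : nat * tree | ~ exists s, truncates p.1 p.2 s}.
have step (p : Bad) : exists q : Bad * bool,
    child q.2 (sval q.1).2 (sval p).2 /\
    ((sval q.1).1 + q.2 <= (sval p).1)%N.
  case: p => [[[|m] [x|c xs ts]] /= hp].
  - by case: hp; exists star; constructor.
  - by case: hp; exists star; constructor.
  - by case: hp; exists (Var x); constructor.
  - have [i hi] : exists i, ~ exists s, truncates (m.+1 - coind i) (ts i) s.
      apply: contrapT => h; apply: hp.
      have /choice[us hus] : forall i, exists s,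
          truncates (m.+1 - coind i) (ts i) s.
        by move=> i; apply: contrapT => hi; apply: h; exists i.
      by exists (Node xs us); constructor.
    exists (exist _ (m.+1 - coind i, ts i)%N hi, coind i); split => /=.
      exact: Child.
    by rewrite subnK //; case: (coind i).
have {step}[f fP] := choice step.
pose p := fix p k : Bad :=
  if k is k'.+1 then (f (p k')).1 else exist _ (n, t) bad.
pose b k := (f (p k)).2.
have inf := mt (fun k => (sval (p k)).2) b erefl (fun k => (fP (p k)).1).
have dec k : ((sval (p k.+1)).1 + b k <= (sval (p k)).1)%N := (fP (p k)).2.
have mono j k : (j <= k)%N -> ((sval (p k)).1 <= (sval (p j)).1)%N.
  move=> /subnK <-; elim: (k - j)%N => // m IH; rewrite addSn.
  by apply: leq_trans IH; apply: leq_trans (dec _); rewrite leq_addr.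
have low m : exists k, ((sval (p k)).1 + m <= n)%N.
  elim: m => [|m [k hk]]; first by exists 0%N; rewrite addn0.
  have [j kj bj] := inf k; exists j.+1.
  have := dec j; rewrite bj addn1 => hj.
  rewrite addnS -addSn; apply: leq_trans hk; rewrite leq_add2r.
  exact: leq_trans hj (mono _ _ kj).
have [k] := low n.+1.
by rewrite addnS ltnNge leq_addl.
Qed.

Definition mtrunc (n : nat) (t : mterm) : term unit :=
  sval (cid (truncates_total (@mtermP t) n)).

Lemma mtruncP n (t : mterm) : truncates n t (mtrunc n t).
Proof. exact: svalP (cid (truncates_total (@mtermP t) n)). Qed.

Definition malpha (t u : mterm) : Prop :=
  forall n, alpha (mtrunc n t) (mtrunc n u).

End Terms.

(* The quotient of [T] by an equivalence relation [r], as the type of its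
   equivalence classes. *)
Definition quot T (r : T -> T -> Prop) : Type :=
  {C : set T | exists t, C = [set u | r t u]}.
Definition qclass T (r : T -> T -> Prop) (t : T) : quot r :=
  exist _ [set u | r t u] (ex_intro _ t erefl).

Definition term_alpha (V : choiceType) (S : mbs) : Type :=
  quot (@alpha V S void).
Definition mterm_alpha (V : choiceType) (S : mbs) : Type :=
  quot (@malpha V S).

Section Completion.
Variables (R : realType) (V : choiceType) (S : mbs).

(* The Arnold-Nivat distance between a finite term and a mixed term. *)
Definition dist (r : term V S void) (t : mterm V S) : R :=
  inf [set 2^-1 ^+ n | n in [set n | trunc n r = mtrunc n t]].

Definition dalpha (C D : term_alpha V S) : R :=
  inf [set 2^-1 ^+ n | n in [set n | exists t u,
    [/\ C = qclass _ t, D = qclass _ u & alpha (trunc n t) (trunc n u)]]].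

Definition cauchy_classes (s : nat -> term_alpha V S) : Prop :=
  forall e : R, 0 < e -> exists N, forall k l, (N <= k)%N -> (N <= l)%N ->
    dalpha (s k) (s l) < e.

(* A point of the Cauchy completion is a class of Cauchy sequences, two of them
   being identified when their distance tends to 0; [limit s] is the limit of
   the Cauchy sequence [s] in the completion. *)
Definition limit (s : nat -> term_alpha V S) : set (nat -> term_alpha V S) :=
  [set s' | cauchy_classes s' /\ dalpha (s k) (s' k) @[k --> \oo] --> (0 : R)].

Definition completion : set (set (nat -> term_alpha V S)) :=
  [set limit s | s in cauchy_classes].

(* The union below is over all representatives [t] and all sequences [r] of
   finite terms converging to [t]; all of them have the same limit. *)
Definition canonical_injection (C : mterm_alpha V S) :
    set (nat -> term_alpha V S) :=
  \bigcup_(r in [set r : nat -> term V S void | exists2 t, C = qclass _ t &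
                   dist (r k) t @[k --> \oo] --> (0 : R)])
    limit (fun k => qclass _ (r k)).

End Completion.

Arguments completion : clear implicits.
Arguments canonical_injection : clear implicits.

(* Main.v *)
(* Two finite terms are alpha-equivalent iff they have the same representation
   by de Bruijn levels, so a point of the completion is an infinite tree with
   free names in V and bound levels in nat. It comes from a mixed term iff the
   levels can be named in V without capturing a free name. Only countably many
   names occur in a Cauchy sequence, so this is possible when V is uncountable.
   When V is countable, a tree with a binder whose scope contains every element
   of V free is a limit of finite terms, but no name is left for its binder. *)
Require Import Defs.
From mathcomp Require Import all_boot all_order all_algebra.
From mathcomp Require Import all_classical all_reals all_analysis.

Set Implicit Arguments.
Unset Strict Implicit.
Unset Printing Implicit Defensive.

Import Order.TTheory GRing.Theory Num.Theory.
Import numFieldNormedType.Exports.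

Local Open Scope classical_set_scope.

Arguments Cst {V S E} e.
Arguments Var {V S E} x.

(** Constructors have decidable equality, so dependent pairs over them are injective in their second
    component; equations between nodes are inverted this way. *)
Lemma node_eq_inv (S : mbs) (P : constructor S -> Type) c (p q : P c) :
  existT P c p = existT P c q -> p = q.
Proof.
apply: Eqdep_dec.inj_pair2_eq_dec => u v.
by case: (eqVneq u v) => [|/eqP]; [left | right].
Qed.

Lemma Node_inj (V : choiceType) (S : mbs) (E : Type) (c : S) xs ys
    (ts us : 'I_(nargs c) -> term V S E) :
  Node xs ts = Node ys us -> xs = ys /\ ts = us.
Proof.
move=> e; inversion e as [[h h']].
by apply node_eq_inv in h; apply node_eq_inv in h'; subst.
Qed.

(** * Replacing bound names by levels *)

Section Levels.
Variables (V W : choiceType) (w : nat -> W).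
Implicit Types (xs zs : seq V) (r : V -> W) (k : nat).

(** Binders are numbered from left to right, so the last occurrence of a repeated name prevails over
    the earlier ones and over [r]. *)
Fixpoint bind k xs r : V -> W :=
  if xs is x :: xs' then bind k.+1 xs' (fun v => if v == x then w k else r v)
  else r.

Lemma bind_notin k xs r v : v \notin xs -> bind k xs r v = r v.
Proof.
elim: xs k r => //= x xs IH k r; rewrite in_cons negb_or => /andP[vx vxs].
by rewrite IH // (negPf vx).
Qed.

Lemma bind_in k xs r r' v : v \in xs -> bind k xs r v = bind k xs r' v.
Proof.
elim: xs k r r' => //= x xs IH k r r'; rewrite in_cons.
have [vxs _|vxs] := boolP (v \in xs); first exact: IH.
by rewrite orbF => vx; rewrite !bind_notin // vx.
Qed.

Lemma bind_range k xs r v : v \in xs -> exists m, bind k xs r v = w m.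
Proof.
elim: xs k r => //= x xs IH k r; rewrite in_cons.
have [vxs _|vxs] := boolP (v \in xs); first exact: IH.
by rewrite orbF => vx; exists k; rewrite bind_notin // vx.
Qed.

Lemma eq_bind k xs r r' v : r v = r' v -> bind k xs r v = bind k xs r' v.
Proof.
move=> e; have [vxs|vxs] := boolP (v \in xs); first exact: bind_in.
by rewrite !bind_notin.
Qed.

Lemma bind_map (s : V -> V) k xs r : injective s ->
  bind k (map s xs) r \o s = bind k xs (r \o s).
Proof.
move=> si; elim: xs k r => //= x xs IH k r; rewrite IH; congr bind.
by apply/funext => v /=; rewrite (inj_eq si).
Qed.

Lemma bind_avoid k xs r v : injective w -> (forall m, k <= m -> r v <> w m) ->
  forall m, k + size xs <= m -> bind k xs r v <> w m.
Proof.
move=> wi; elim: xs k r => [|x xs IH] k r h /= m; first by rewrite addn0; apply: h.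
rewrite addnS -addSn; apply: IH => {}m km; case: eqP => [_ /wi e|_].
  by rewrite e ltnn in km.
by apply: h; apply: ltnW.
Qed.

Definition level_inj k r :=
  injective r /\ forall v m, k <= m -> r v <> w m.

Lemma bind_level_inj k xs r : injective w -> level_inj k r ->
  level_inj (k + size xs) (bind k xs r).
Proof.
move=> wi [ri rw]; split=> [|v m]; last first.
  by apply: bind_avoid => // {}m; exact: rw.
elim: xs k r ri rw => //= x xs IH k r ri rw; apply: IH => [u v|v m km].
  case: (eqVneq u x) (eqVneq v x) => [->|ux] [->|vx] //; last exact: ri.
    by move=> /esym/(rw _ _ (leqnn k)).
  by move=> /(rw _ _ (leqnn k)).
by apply: (@bind_avoid k [:: x]) => //; [exact: rw|rewrite addn1].
Qed.

End Levels.

(** The binders of a relevelled term are [w k], [w k.+1] and so on; binding them again amounts to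
    binding [xs] directly, as long as none of them captures [r v]. *)
Lemma bind_comp (V W U : choiceType) (w : nat -> W) (w' : nat -> U)
    k (xs : seq V) (r : V -> W) (r' : W -> U) (r'' : V -> U) v :
  injective w -> r' (r v) = r'' v -> (forall m, k <= m -> r v <> w m) ->
  bind w' k [seq w m | m <- iota k (size xs)] r' (bind w k xs r v) =
  bind w' k xs r'' v.
Proof.
move=> wi; elim: xs k r r' r'' => //= x xs IH k r r' r'' e h.
apply: IH => /=.
- case: (eqVneq v x) => _; first by rewrite eqxx.
  by case: eqP => // /h -/(_ (leqnn k)).
- move=> m km; case: ifP => _; last by apply: h; apply: ltnW.
  by move/wi => e'; rewrite e' ltnn in km.
Qed.

(** * Transpositions with fresh names *)

Section Transpositions.
Variable V : choiceType.

Lemma transp_inj (x z : V) : injective (transp x z).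
Proof.
by move=> u v; rewrite /transp; do ![case: eqP => ?]; congruence.
Qed.

Lemma transps_inj n (xs zs : n.-tuple V) : injective (transps xs zs).
Proof.
rewrite /transps; elim: (zip xs zs) => //= p s IH u v.
by move/transp_inj/IH.
Qed.

(** [transps] on plain lists, whose lengths may change during an induction. *)
Definition ptransps (s : seq (V * V)) v := foldr (fun p => transp p.1 p.2) v s.

Lemma ptransps_notin xs zs v : v \notin xs -> v \notin zs ->
  ptransps (zip xs zs) v = v.
Proof.
elim: xs zs => [|a l IH] [|b m] //=.
rewrite !in_cons !negb_or => /andP[ya yl] /andP[yb ym].
by rewrite -/(ptransps _ _) IH // /transp (negPf ya) (negPf yb).
Qed.

(** Once a name has landed in [zs], the outer transpositions fix it, because [zs] has no repetition
    and is disjoint from [xs]. *)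
Lemma ptransps_in xs zs v : size xs = size zs -> v \in xs -> uniq zs ->
  {in zs, forall z, z \notin xs} -> ptransps (zip xs zs) v \in zs.
Proof.
elim: xs zs => // x xs IH [|z zs] //= [sz]; rewrite in_cons.
move=> vxs /andP[zzs uzs] d; rewrite -/(ptransps _ _).
have d' y : y \in zs -> y != x /\ y \notin xs.
  move=> yzs; have := d y; rewrite !in_cons yzs orbT negb_or.
  by move=> /(_ isT)/andP[].
have [vin|vnin] := boolP (v \in xs).
  have h : ptransps (zip xs zs) v \in zs by apply: IH => // y /d'[].
  have [nx _] := d' _ h.
  rewrite /transp (negPf nx) ifN ?in_cons ?h ?orbT //.
  by apply: contraNneq zzs => <-.
move: vxs; rewrite (negPf vnin) orbF => /eqP vx.
rewrite ptransps_notin //; first by rewrite /transp vx eqxx mem_head.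
by apply/negP => /d'[]; rewrite vx eqxx.
Qed.

(* The last occurrence of a repeated name prevails on both sides. *)
Lemma bind_ptransps (W : choiceType) (w : nat -> W) xs zs k r v :
  size xs = size zs -> uniq zs -> {in zs, forall z, z \notin xs} ->
  v \notin zs -> bind w k zs r (ptransps (zip xs zs) v) = bind w k xs r v.
Proof.
elim: xs zs k r => [|x xs IH] [|z zs] // k r [sz].
move=> /= /andP[zzs uzs] d; rewrite in_cons negb_or => /andP[vz vzs].
have d' y : y \in z :: zs -> y != x /\ y \notin xs.
  by move=> /d; rewrite in_cons negb_or => /andP[].
have dzs : {in zs, forall y, y \notin xs}.
  by move=> y yzs; apply: (d' y _).2; rewrite in_cons yzs orbT.
have xzs : x \notin zs.
  by apply/negP => h; case: (d' x); rewrite ?in_cons ?h ?orbT ?eqxx.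
rewrite -/(ptransps _ _); have [vxs|vxs] := boolP (v \in xs).
  have h := ptransps_in sz vxs uzs dzs.
  rewrite /transp ifN ?ifN.
  - by rewrite IH //; apply: bind_in.
  - by apply: contraNneq zzs => <-.
  - by apply: contraNneq xzs => <-.
rewrite ptransps_notin // /transp (negPf vz); case: eqP => [vx|vx].
  by rewrite !bind_notin // ?vx ?eqxx // -vx.
by rewrite !bind_notin // (negPf vz); case: eqP vx.
Qed.

Lemma bind_transps (W : choiceType) (w : nat -> W) n (xs zs : n.-tuple V) k r v :
  uniq zs -> {in zs, forall z, z \notin xs} -> v \notin zs ->
  bind w k zs r (transps xs zs v) = bind w k xs r v.
Proof. by apply: bind_ptransps; rewrite !size_tuple. Qed.

End Transpositions.

(** * De Bruijn levels as canonical forms for alpha-equivalence *)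

Section Canon.
Variables (V : choiceType) (S : mbs).

(* For [w := inr : nat -> V + nat] and [r := inl] this is the representation by
   de Bruijn levels, [k] being the number of binders already crossed. *)
Fixpoint relevel (W : choiceType) (w : nat -> W) E k (r : V -> W)
    (t : term V S E) : term W S E :=
  match t with
  | Cst e => Cst e
  | Var x => Var (r x)
  | Node c xs ts =>
      Node (fun i => map_tuple w (iota_tuple (binds i) k))
           (fun i => relevel w (k + binds i) (bind w k (xs i) r) (ts i))
  end.

Lemma occurs_arg E c xs (ts : 'I_(nargs c) -> term V S E) i v :
  occurs v (ts i) -> occurs v (Node xs ts).
Proof. by move=> h /=; apply/existsP; exists i; rewrite h orbT. Qed.

Lemma eq_relevel (W : choiceType) (w : nat -> W) E k r r' (t : term V S E) :
  (forall v, occurs v t -> r v = r' v) -> relevel w k r t = relevel w k r' t.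
Proof.
elim: t k r r' => //= [x|c xs ts IH] k r r' h; first by rewrite h ?eqxx.
congr Node; apply/funext => i; apply: IH => v vi.
by apply: eq_bind; apply: h; apply: (@occurs_arg _ _ xs ts i).
Qed.

Lemma relevel_rename (W : choiceType) (w : nat -> W) E k r s (t : term V S E) :
  injective s -> relevel w k r (rename s t) = relevel w k (r \o s) t.
Proof.
move=> si; elim: t k r => //= c xs ts IH k r.
by congr Node; apply/funext => i; rewrite IH -bind_map.
Qed.

Lemma rename_comp E (s s' : V -> V) (t : term V S E) :
  rename s (rename s' t) = rename (s \o s') t.
Proof.
elim: t => //= c xs ts IH; congr Node; apply: functional_extensionality_dep => i //.
by apply: val_inj; rewrite /= map_comp.
Qed.

Lemma rename_id E (t : term V S E) : rename id t = t.
Proof.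
elim: t => //= c xs ts IH; congr Node; apply: functional_extensionality_dep => i //.
by apply: val_inj; rewrite /= map_id.
Qed.

(** The fresh names take over the levels of the binders they replace, and they do not occur in [t]
    otherwise. *)
Lemma relevel_transps (W : choiceType) (w : nat -> W) E k r
    n (zs xs : n.-tuple V) (t : term V S E) :
  uniq zs -> (forall z, z \in zs -> z \notin xs /\ ~~ occurs z t) ->
  relevel w (k + n) (bind w k zs r) (rename (transps xs zs) t) =
  relevel w (k + n) (bind w k xs r) t.
Proof.
move=> uzs f; rewrite relevel_rename; last exact: transps_inj.
apply: eq_relevel => v vt /=; apply: bind_transps => // [z /f[]//|].
by apply/negP => /f[_]; rewrite vt.
Qed.

(** By [relevel_transps] both bodies can first be moved to the common fresh names [zs i], where the
    induction hypothesis applies with one renaming for both sides. *)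
Lemma alpha_relevel (W : choiceType) (w : nat -> W) E k r (t u : term V S E) :
  alpha t u -> relevel w k r t = relevel w k r u.
Proof.
move=> h; elim: h k r => // {t u} c xs ys zs ts us fr _ IH k r /=.
congr Node; apply/funext => i; have [uzs f] := fr i.
rewrite -(@relevel_transps _ _ _ _ _ _ (zs i)) => [|//|z /f[]//].
by rewrite IH relevel_transps // => z /f[].
Qed.

Lemma trunc_relevel (W : choiceType) (w : nat -> W) n k r (t : term V S void) :
  trunc n (relevel w k r t) = relevel w k r (trunc n t).
Proof.
elim: t n k r => [[]|x|c xs ts IH] [|n] k r //=.
by congr Node; apply/funext => i; rewrite IH.
Qed.

(** Bound and binding names all become levels [w m], so a name outside the range of [w] can only
    come from [r]. *)
Lemma occurs_relevel (U W : choiceType) (w : nat -> W) (f : U -> W) E k r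
    (t : term V S E) u : (forall m, f u <> w m) ->
  occurs (f u) (relevel w k r t) -> exists v, r v = f u.
Proof.
move=> fw; elim: t k r => //= [x|c xs ts IH] k r.
  by move/eqP => ->; exists x.
move=> /existsP[i /orP[/mapP[m _ /fw]//|/IH[v hv]]].
have [vxs|vxs] := boolP (v \in xs i); last first.
  by exists v; rewrite -hv bind_notin.
have [m hm] := bind_range w k r vxs.
by case: (fw m); rewrite -hv hm.
Qed.

Lemma occurs_finite E (t : term V S E) : finite_set [set v | occurs v t].
Proof.
elim: t => [e|x|c xs ts IH] /=.
- rewrite (_ : mkset _ = set0); first exact: finite_set0.
  by apply/seteqP; split.
- apply: sub_finite_set (finite_set1 x) => v /= /eqP //.
- apply: (@sub_finite_set _ _
    (\bigcup_(i in [set: 'I_(nargs c)]) ([set` xs i] `|` [set v | occurs v (ts i)]))).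
    by move=> v /existsP[i /orP[h|h]]; exists i => //; [left|right].
  apply: bigcup_finite => // i _; rewrite finite_setU; split=> //; exact: finite_seq.
Qed.

Hypothesis V_infinite : infinite_set [set: V].

Lemma exists_notin (A : set V) : finite_set A -> exists z, ~ A z.
Proof.
move=> fA; apply: contrapT => h; apply: V_infinite.
apply: sub_finite_set fA => z _; apply: contrapT => nz; apply: h.
by exists z.
Qed.

Lemma exists_notin_tuple (A : set V) n : finite_set A ->
  exists zs : n.-tuple V, uniq zs /\ forall z, z \in zs -> ~ A z.
Proof.
move=> fA; elim: n => [|n [zs [uzs h]]]; first by exists [tuple].
have [z] : exists z, ~ (A `|` [set` zs]) z.
  by apply: exists_notin; rewrite finite_setU; split=> //; exact: finite_seq.
move=> /not_orP[nA /negP nz]; exists (cons_tuple z zs); split=> /=.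
  by rewrite nz.
by move=> y; rewrite in_cons => /predU1P[->|/h].
Qed.

Lemma relevel_alpha (W : choiceType) (w : nat -> W) E k r (t u : term V S E) :
  injective w -> level_inj w k r ->
  relevel w k r t = relevel w k r u -> alpha t u.
Proof.
(* The bodies to be compared are renamed subterms, hence not structurally smaller. The induction
   therefore treats [rename s t] for every injective [s], starting from the identity. *)
move=> wi; rewrite -(rename_id t); move: (@inj_id V).
elim: t u k r id => [e|x|c xs ts IH] [e'|y|c' ys us] k r s si //= lr.
- by case=> ->; constructor.
- by case=> /lr.1 ->; constructor.
move=> eqN; have ? : c = c' by case: eqN.
subst c'; have [_ /(congr1 (fun f => f _)) eqt] := Node_inj eqN.
have exz : forall i, exists zs : (binds i).-tuple V,
    fresh zs (map_tuple s (xs i)) (ys i) (rename s (ts i)) (us i).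
  move=> i; have [|zs [uzs h]] := @exists_notin_tuple
    ([set` map s (xs i)] `|` ([set` ys i] `|`
     ([set v | occurs v (rename s (ts i))] `|` [set v | occurs v (us i)])))
    (binds i).
    by rewrite !finite_setU; do !split; by [exact: finite_seq|exact: occurs_finite].
  exists zs; split=> // z /h nz.
  by split; apply/negP => hz; apply: nz; rewrite /setU /=; tauto.
pose zs i := sval (cid (exz i)).
have hzs i : fresh (zs i) _ _ _ _ := svalP (cid (exz i)).
apply: (alpha_node hzs) => i; have [uzs f] := hzs i.
rewrite rename_comp; apply: (IH i _ (k + binds i) (bind w k (zs i) r)).
- exact: inj_comp (@transps_inj _ _ _ _) si.
- by have := bind_level_inj (zs i) wi lr; rewrite size_tuple.
- by rewrite -rename_comp !relevel_transps // => z /f[].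
Qed.

(** In [V + nat] free names and levels are disjoint, so the invariant [level_inj] holds at depth
    0. *)
Lemma alphaP E (t u : term V S E) :
  alpha t u <-> relevel (W := (V + nat)%type) inr 0 inl t = relevel inr 0 inl u.
Proof.
split; first exact: alpha_relevel.
by apply: relevel_alpha; [move=> ? ? []|split=> // ? ? []].
Qed.

End Canon.

(** Serves to show that naming the levels by foreign variables yields an alpha-equivalent term: its
    de Bruijn levels are those of the original. *)
Lemma relevel_relevel (V W U : choiceType) (S : mbs) (w : nat -> W) (w' : nat -> U)
    E k r r' r'' (t : term V S E) : injective w ->
  (forall v, occurs v t -> r' (r v) = r'' v /\ forall m, k <= m -> r v <> w m) ->
  relevel w' k r' (relevel w k r t) = relevel w' k r'' t.
Proof.
move=> wi; elim: t k r r' r'' => //= [x|c xs ts IH] k r r' r'' h.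
  by rewrite (h x _).1 ?eqxx.
congr Node; apply/funext => i; apply: IH => v vi.
have [e d] := h v (occurs_arg xs vi); split.
  by have := bind_comp w' (xs i) wi e d; rewrite size_tuple.
by move=> m km; apply: (bind_avoid wi d); rewrite size_tuple.
Qed.
(** * Truncations and completeness of trees *)

Section Trees.
Variables (V : choiceType) (S : mbs).
Implicit Types (a b : term V S void) (t : tree V S) (r : nat -> term V S void).

Lemma trunc_at0 a : trunc 0 a = star V S.
Proof. by case: a => [[]||]. Qed.

Lemma eq_trunc_le k n a b : trunc k a = trunc k b -> n <= k ->
  trunc n a = trunc n b.
Proof.
elim: a b k n => [[]|x|c xs ts IH] b [|k] [|n] //; case: b => [[]|y|c' ys us] //= e nk.
have ? : c = c' by case: e.
subst c'; have [-> /(congr1 (fun f => f _)) h] := Node_inj e.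
congr Node; apply/funext => i; apply: IH (h i) _.
by apply: leq_sub2r.
Qed.

Lemma truncates_TNode n c xs (ts : 'I_(nargs c) -> tree V S) s :
  truncates n.+1 (TNode xs ts) s -> exists us, s = Node xs us /\
    forall i, truncates (n.+1 - coind i) (ts i) (us i).
Proof.
move=> h; inversion h as [| |n' c' xs' ts' us hus]; subst.
by do ![match goal with e : existT _ _ _ = _ |- _ =>
  apply node_eq_inv in e; subst end]; exists us.
Qed.

Lemma truncates_le k n t a : truncates k t (trunc k a) -> n <= k ->
  truncates n t (trunc n a).
Proof.
elim: a t k n => [[]|x|c xs ts IH] [y|c' ys us] [|k] [|n] //= h nk.
all: try by [constructor | inversion h; constructor].
have [vs [e hvs]] := truncates_TNode h.
have ? : c = c' by case: e.
subst c'; have [? h'] := Node_inj e; subst ys vs.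
by apply: truncates_node => i; apply: IH (hvs i) _; apply: leq_sub2r.
Qed.

Lemma child_truncates n d t t' s : child d t' t -> truncates n.+1 t s ->
  exists c xs (us : 'I_(nargs c) -> term V S unit) i,
    s = Node xs us /\ truncates (n.+1 - d) t' (us i).
Proof.
by case=> c xs ts i /truncates_TNode[us [-> h]]; exists c, xs, us, i.
Qed.

(** A branch that crosses no coinductive argument from some point on would lie entirely inside a
    truncation at depth 1, which is a finite term. *)
Lemma mixed_truncates t : (forall n, exists s, truncates n t s) -> mixed t.
Proof.
move=> tot u b u0 ch n; apply: contrapT => inf.
have totk k m : exists s, truncates m (u k) s.
  elim: k m => [|k IH] [|m]; rewrite ?u0 //; first by exists (star V S); constructor.
  (* This depth is positive and leaves exactly [m.+1] for the child, whatever the flag [b k]. *)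
  have [s hs] := IH (m + b k).+1.
  have [c [xs [us [i [_]]]]] := child_truncates (ch k) hs.
  by rewrite -addSn addnK => h; exists (us i).
have bn k : n <= k -> b k = false.
  by move=> nk; apply/negP => bk; apply: inf; exists k.
have [s] := totk n 1.
suff h k : n <= k -> ~ truncates 1 (u k) s by exact: h.
elim: s k => [e|x|c xs ss IH] k nk h.
all: have [c' [xs' [us [i [e']]]]] := child_truncates (ch k) h.
all: rewrite bn // => h'; try by [].
have ? : c = c' by case: e'.
subst c'; have [_ ?] := Node_inj e'; subst us.
by apply: IH h'; apply: leqW.
Qed.

(** Turns a truncation back into a genuine finite term; the variable put in place of [star] is
    arbitrary, since truncating again erases it. *)
Fixpoint fill (x0 : V) (s : term V S unit) : term V S void :=
  match s with
  | Cst _ => Var x0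
  | Var x => Var x
  | Node c xs ts => Node xs (fun i => fill x0 (ts i))
  end.

Lemma trunc_fill x0 n t s : truncates n t s -> trunc n (fill x0 s) = s.
Proof.
elim => {n t s}// n c xs ts us _ IH /=.
by congr Node; apply/funext => i; rewrite IH.
Qed.

(** A total projection, because the terms of a sequence are not known by typing to share their head
    constructor; the default [a] is arbitrary. *)
Definition arg j a : term V S void :=
  if a is Node c xs ts then
    if insub j is Some i then ts i else a
  else a.

Lemma argE c xs (ts : 'I_(nargs c) -> term V S void) (i : 'I_(nargs c)) :
  arg i (Node xs ts) = ts i.
Proof. by rewrite /arg valK. Qed.

Definition coherent r := forall n m, n <= m -> trunc n (r n) = trunc n (r m).

(* The shift to [r n.+1] pays for the unit of depth lost in a coinductive
   argument; it is harmless for an inductive one. *)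
CoFixpoint lim_tree r : tree V S :=
  match r 1 with
  | Cst e => match e with end
  | Var x => TVar S x
  | Node c xs ts => TNode xs (fun i => lim_tree (fun n => arg i (r n.+1)))
  end.

Lemma lim_treeE r : lim_tree r =
  match r 1 with
  | Cst e => match e with end
  | Var x => TVar S x
  | Node c xs ts => TNode xs (fun i => lim_tree (fun n => arg i (r n.+1)))
  end.
Proof.
have unfold (t : tree V S) : t = match t with TVar x => TVar S x
  | TNode c xs ts => TNode xs ts end by case: t.
by rewrite [LHS]unfold /=; case: (r 1) => [[]|x|c xs ts].
Qed.

Lemma coherent_node r c xs (ts : 'I_(nargs c) -> term V S void) :
  coherent r -> r 1 = Node xs ts -> forall n, exists us : 'I_(nargs c) -> _,
  r n.+1 = Node xs us.
Proof.
move=> h e n; have := h 1 n.+1 isT; rewrite e.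
case: (r n.+1) => [[]|//|c' ys us] e'.
have ? : c = c' by case: e'.
by subst c'; have [-> _] := Node_inj e'; exists us.
Qed.

Lemma coherent_arg r c xs (ts : 'I_(nargs c) -> term V S void) (i : 'I_(nargs c)) :
  coherent r -> r 1 = Node xs ts -> coherent (fun n => arg i (r n.+1)).
Proof.
move=> h e n m nm.
have [us eu] := coherent_node h e n; have [vs ev] := coherent_node h e m.
have := h n.+1 m.+1 nm; rewrite eu ev !argE.
move=> /Node_inj[_ /(congr1 (fun f => f i)) /eq_trunc_le]; apply.
by case: (coind i); rewrite ?subn1 ?subn0.
Qed.

(** The induction is on the finite truncation, since the depth does not decrease at inductive
    arguments. *)
Lemma truncates_lim_tree r n : coherent r -> truncates n (lim_tree r) (trunc n (r n)).
Proof.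
move=> cr; move es: (trunc n (r n)) => s.
elim: s r n cr es => [e|x|c xs ss IH] r [|n] cr es.
- by rewrite -es trunc_at0; exact: truncates_0.
- by move: es; case: (r n.+1) => [[]|x|].
- by rewrite trunc_at0 in es.
- move: es (cr 1 n.+1 isT); rewrite lim_treeE.
  case: (r n.+1) => [[]|y [->]|//].
  by case: (r 1) => [[]|z [->]|//]; constructor.
- by rewrite trunc_at0 in es.
move: es; case en: (r n.+1) => [[]|//|c' ys us] es.
have ? : c' = c by case: es.
subst c'; have [? /(congr1 (fun f => f _)) h] := Node_inj es; subst ys.
have := cr 1 n.+1 isT; rewrite lim_treeE en.
case e1: (r 1) => [[]|//|c' ys ts] e'.
have ? : c' = c by case: e'.
subst c'; have [? _] := Node_inj e'; subst ys.
apply: truncates_node => i; apply: IH; first exact: coherent_arg e1.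
(* A coinductive argument is read off [r n.+1], an inductive one off [r n.+2], which agrees with
   [r n.+1] at depth [n.+1]. *)
rewrite -h; have [vs ev] := coherent_node cr e1 n.+1.
have := cr n.+1 n.+2 (leqnSn _); rewrite en ev.
move=> /Node_inj[_ /(congr1 (fun f => f i))]; case: (coind i).
  by rewrite subn1 en argE.
by rewrite subn0 ev argE => ->.
Qed.

Lemma coherent_mixed r : coherent r -> mixed (lim_tree r).
Proof.
move=> cr; apply: mixed_truncates => n; exists (trunc n (r n)).
exact: truncates_lim_tree.
Qed.

Lemma truncates_mtrunc n (t : mterm V S) s : truncates n t s -> s = mtrunc n t.
Proof. by move/truncates_uniq; apply; exact: mtruncP. Qed.

Lemma mtrunc_le k n a (t : mterm V S) : trunc k a = mtrunc k t -> n <= k ->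
  trunc n a = mtrunc n t.
Proof.
move=> e nk; apply/truncates_mtrunc/(truncates_le _ nk).
by rewrite e; exact: mtruncP.
Qed.

Lemma mterm_complete r :
  (forall n, exists N, forall k l, N <= k -> N <= l ->
    trunc n (r k) = trunc n (r l)) ->
  exists t : mterm V S, forall n, exists N, forall k, N <= k ->
    trunc n (r k) = mtrunc n t.
Proof.
(* [M n] lies beyond the stabilisation index of every depth up to [n], which makes the subsequence
   [r \o M] coherent. *)
move=> /choice[N hN]; pose M n := \max_(m < n.+1) N m.
have NM n m : m <= n -> N m <= M n.
  by move=> mn; apply: (@leq_bigmax _ (fun i : 'I_n.+1 => N i) (Ordinal (mn : m < n.+1))).
have cr : coherent (r \o M).
  by move=> n m nm /=; apply: hN; apply: NM.
exists (MTerm (coherent_mixed cr)) => n; exists (N n) => k nk.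
apply: truncates_mtrunc; rewrite (hN n k (M n)) //; last exact: NM.
exact: truncates_lim_tree.
Qed.

Lemma mtrunc_fill x0 (t : mterm V S) n k : n <= k ->
  trunc n (fill x0 (mtrunc k t)) = mtrunc n t.
Proof.
apply: mtrunc_le; apply: trunc_fill; exact: mtruncP.
Qed.

End Trees.

(** * The metric completion *)

Section Ultrametric.
Variable R : realType.
Local Open Scope ring_scope.
Implicit Types (P : set nat).

(** The common shape of [dist] and [dalpha], [P] being the downward closed set of depths at which
    two terms agree. *)
Let inf2 P : R := inf [set 2^-1 ^+ n | n in P].

Lemma expr_half_gt0 n : 0 < 2^-1 ^+ n :> R.
Proof. by rewrite exprn_gt0 // invr_gt0. Qed.

Lemma inf2_ge0 P : P 0%N -> 0 <= inf2 P.
Proof.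
move=> P0; apply: lb_le_inf; first by exists (2^-1 ^+ 0), 0%N.
by move=> _ [n _ <-]; apply/ltW/expr_half_gt0.
Qed.

Lemma inf2_le P n : P n -> inf2 P <= 2^-1 ^+ n.
Proof.
move=> Pn; apply: ge_inf; last by exists n.
by exists 0 => _ [m _ <-]; apply/ltW/expr_half_gt0.
Qed.

Lemma inf2_lt P n : (forall m k, P m -> (k <= m)%N -> P k) -> P 0%N ->
  inf2 P < 2^-1 ^+ n -> P n.
Proof.
move=> dP P0 /inf_lt[|_ [m Pm <-]]; first by exists (2^-1 ^+ 0), 0%N.
rewrite ltr_iXn2l ?invr_gt0 ?invf_lt1 ?ltr1n // => nm.
by apply: dP Pm _; apply: ltnW.
Qed.

Lemma exists_expr_half (e : R) : 0 < e -> exists n, 2^-1 ^+ n < e.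
Proof.
move=> e0; have [N _ /(_ N (leqnn N))] := near_infty_natSinv_expn_lt (PosNum e0).
by rewrite /= div1r -exprVn; exists N.
Qed.

(** Removes real numbers from the later arguments: since the powers of one half tend to 0,
    convergence is eventual agreement at each depth. *)
Lemma inf2_cvg0 (P : nat -> set nat) :
  (forall k m n, P k m -> (n <= m)%N -> P k n) -> (forall k, P k 0%N) ->
  inf2 (P k) @[k --> \oo] --> 0 <->
  forall n, exists N, forall k, (N <= k)%N -> P k n.
Proof.
move=> dP P0; split=> [/cvgrPdist_lt h n|h].
  have [N _ hN] := h _ (expr_half_gt0 n); exists N => k /hN /=.
  rewrite sub0r normrN ger0_norm ?inf2_ge0 //.
  by apply: inf2_lt => //; apply: dP.
apply/cvgrPdist_lt => e /exists_expr_half[n hn]; have [N hN] := h n.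
exists N => // k /= /hN Pkn.
rewrite sub0r normrN ger0_norm ?inf2_ge0 //.
by apply: le_lt_trans hn; apply: inf2_le.
Qed.

End Ultrametric.

(** * Equivalence classes and countability *)

Section Quotient.
Variables (T : Type) (r : T -> T -> Prop).
Hypotheses (rr : forall t, r t t) (rs : forall t u, r t u -> r u t).
Hypothesis rt : forall t u v, r t u -> r u v -> r t v.

Lemma qclassP t u : qclass r t = qclass r u <-> r t u.
Proof.
split=> [/(congr1 sval) /= e|tu].
  by have : [set v | r u v] u := rr u; rewrite -e.
apply: eq_exist; apply/seteqP; split=> v /=; last exact: rt.
by apply: rt; apply: rs.
Qed.

Lemma qclass_surj (C : quot r) : exists t, C = qclass r t.
Proof. by case: C => C [t e]; exists t; apply: eq_exist. Qed.

End Quotient.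
Lemma infinite_inj (T : Type) (A : set T) : infinite_set A ->
  exists w : nat -> T, injective w /\ forall n, A (w n).
Proof.
move=> Ai; have [x _] : A !=set0 by apply/set0P; apply: contra_notN Ai => /eqP ->.
have /card_leP/unsquash f := (infiniteP A).1 Ai.
exists (valLR x f); split=> [i j|n].
  by apply: (@inj _ _ _ (valLR x f)); rewrite in_setT.
exact: (@funS _ _ _ _ (valLR x f)).
Qed.
Lemma countable_setC (T : Type) (A : set T) : countable A -> countable (~` A) -> countable [set: T].
Proof.
move=> cA cC; have -> : [set: T] = \bigcup_(b in [set: bool]) (if b then A else ~` A).
  apply/seteqP; split=> // x _; have [Ax|Ax] := pselect (A x).
    by exists true.
  by exists false.
by apply: bigcup_countable => // -[].
Qed.

(** * The canonical injection, and its surjectivity for uncountably many variables *)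

Section Completion.
Variables (R : realType) (V : choiceType) (S : mbs).
Hypothesis V_infinite : infinite_set [set: V].

Implicit Types (a b c : nat -> term V S void) (t u : mterm V S).

Lemma alpha_refl E (x : term V S E) : alpha x x.
Proof. exact/alphaP. Qed.

Lemma alpha_sym E (x y : term V S E) : alpha x y -> alpha y x.
Proof. by move/(alphaP V_infinite) => e; apply/alphaP. Qed.

Lemma alpha_trans E (x y z : term V S E) : alpha x y -> alpha y z -> alpha x z.
Proof.
move=> /(alphaP V_infinite) h /(alphaP V_infinite) h'.
by apply/(alphaP V_infinite); rewrite h.
Qed.

Definition talpha n (x y : term V S void) := alpha (trunc n x) (trunc n y).

(** Truncation commutes with relevelling, so agreement up to alpha at a given depth becomes equality
    of truncations, which is visibly monotone in the depth. *)
Lemma talphaP n x y : talpha n x y <->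
  trunc n (relevel (W := (V + nat)%type) inr 0 inl x) =
  trunc n (relevel inr 0 inl y).
Proof. by rewrite !trunc_relevel; apply: alphaP. Qed.

Lemma talpha_le k n x y : talpha k x y -> n <= k -> talpha n x y.
Proof.
by move=> /talphaP h nk; apply/talphaP; apply: eq_trunc_le h nk.
Qed.

Lemma alpha_talpha n x y : alpha x y -> talpha n x y.
Proof. by move=> /(alphaP V_infinite) h; apply/talphaP; rewrite h. Qed.

Lemma talpha0 x y : talpha 0 x y.
Proof. by rewrite /talpha !trunc_at0; exact: alpha_refl. Qed.

Lemma malpha_refl t : malpha t t.
Proof. by move=> n; apply: alpha_refl. Qed.

Lemma malpha_sym t u : malpha t u -> malpha u t.
Proof. by move=> h n; apply: alpha_sym. Qed.

Lemma malpha_trans t u v : malpha t u -> malpha u v -> malpha t v.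
Proof. by move=> h h' n; apply: alpha_trans (h n) (h' n). Qed.

Let cls a k : term_alpha V S := qclass _ (a k).

Lemma cls_surj (s : nat -> term_alpha V S) : exists a, s = cls a.
Proof.
have /choice[a ha] : forall k, exists x, s k = qclass _ x.
  by move=> k; exact: qclass_surj.
by exists a; apply/funext.
Qed.

(** [stable], [asymptotic] and [converges] express on representatives, depth by depth, a Cauchy
    sequence, a distance tending to 0, and convergence in the Arnold-Nivat metric. *)
Definition stable a := forall n, exists N, forall k l, N <= k -> N <= l ->
  talpha n (a k) (a l).

Definition asymptotic a b := forall n, exists N, forall k, N <= k ->
  talpha n (a k) (b k).

Definition converges a t := forall n, exists N, forall k, N <= k ->
  trunc n (a k) = mtrunc n t.

Lemma asymptotic_sym a b : asymptotic a b -> asymptotic b a.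
Proof.
by move=> h n; have [N hN] := h n; exists N => k /hN; apply: alpha_sym.
Qed.

Lemma asymptotic_trans a b c : asymptotic a b -> asymptotic b c -> asymptotic a c.
Proof.
move=> h h' n; have [N hN] := h n; have [N' hN'] := h' n.
exists (maxn N N') => k; rewrite geq_max => /andP[/hN + /hN'].
exact: alpha_trans.
Qed.

(** Alpha-equivalent terms agree at every depth, so the representatives chosen in [dalpha] do not
    matter. *)
Lemma dalphaE x y : dalpha R (qclass (@alpha V S void) x) (qclass _ y) =
  inf [set (2^-1 ^+ n)%R | n in [set n | talpha n x y]].
Proof.
rewrite /dalpha; congr (inf (image _ _)); apply/seteqP; split=> n /=; last first.
  by exists x, y.
have q := qclassP (@alpha_refl void) (@alpha_sym void) (@alpha_trans void).
move=> [x' [y' [/q /(alpha_talpha n) xx /q /(alpha_talpha n) yy xy]]].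
exact: alpha_trans xx (alpha_trans xy (alpha_sym yy)).
Qed.

Lemma cauchy_classesP a : cauchy_classes R (cls a) <-> stable a.
Proof.
split=> [h n|h e /exists_expr_half[n hn]].
  have [N hN] := h _ (expr_half_gt0 R n); exists N => k l Nk Nl.
  have := hN _ _ Nk Nl; rewrite dalphaE; apply: inf2_lt; last exact: talpha0.
  by move=> ? ?; apply: talpha_le.
have [N hN] := h n; exists N => k l Nk Nl; rewrite dalphaE.
by apply: le_lt_trans hn; apply: inf2_le; apply: hN.
Qed.

Lemma limitP a b : limit R (cls a) (cls b) <-> stable b /\ asymptotic a b.
Proof.
rewrite /limit /= cauchy_classesP.
under eq_fun do rewrite dalphaE.
rewrite (inf2_cvg0 R (P := fun k => [set n | talpha n (a k) (b k)])) //.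
  by move=> k m n /= ? ?; apply: talpha_le; eassumption.
by move=> k; exact: talpha0.
Qed.

Lemma eq_limit a b : asymptotic a b -> limit R (cls a) = limit R (cls b).
Proof.
move=> h; apply/seteqP; split=> s; have [c ->] := cls_surj s => /limitP[sc hc];
  apply/limitP; split=> //; apply: asymptotic_trans hc => //; exact: asymptotic_sym.
Qed.

Lemma distP a t : dist R (a k) t @[k --> \oo] --> (0 : R)%R <-> converges a t.
Proof.
apply: inf2_cvg0 => [k m n /= e|k /=]; first exact: mtrunc_le.
by rewrite trunc_at0; apply: truncates_mtrunc; constructor.
Qed.

Lemma converges_exists t : exists a, converges a t.
Proof.
have [x0 _] : exists x0 : V, ~ set0 x0 by apply: exists_notin.
exists (fun k => fill x0 (mtrunc k t)) => n; exists n => k; exact: mtrunc_fill.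
Qed.

Lemma converges_stable a t : converges a t -> stable a.
Proof.
move=> h n; have [N hN] := h n; exists N => k l /hN e /hN e'.
by rewrite /talpha e e'; apply: alpha_refl.
Qed.

(** From left to right this gives injectivity of the canonical map; from right to left, its
    independence of the representative and of the approximating sequence. *)
Lemma converges_asymptotic a b t u : converges a t -> converges b u -> asymptotic a b <-> malpha t u.
Proof.
move=> at_ bu; split=> h n.
  have [N hN] := h n; have [M hM] := at_ n; have [K hK] := bu n.
  have := hN (maxn N (maxn M K)) (leq_maxl _ _).
  by rewrite /talpha hM ?hK // !leq_max leqnn !orbT.
have [M hM] := at_ n; have [K hK] := bu n; exists (maxn M K) => k.
by rewrite geq_max => /andP[/hM e /hK e']; rewrite /talpha e e'; exact: h.
Qed.

Lemma mqclassP t u : qclass (@malpha V S) t = qclass _ u <-> malpha t u.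
Proof. exact: qclassP malpha_refl malpha_sym malpha_trans _ _. Qed.

Lemma canonical_injectionE a t : converges a t ->
  canonical_injection R V S (qclass _ t) = limit R (cls a).
Proof.
move=> at_; apply/seteqP; split=> [s [b [u /mqclassP tu /distP bu]]|s h].
  by rewrite -(eq_limit ((converges_asymptotic at_ bu).2 tu)).
by exists a => //; exists t => //; apply/distP.
Qed.

Lemma canonical_injection_fun :
  set_fun [set: mterm_alpha V S] (completion R V S) (canonical_injection R V S).
Proof.
move=> C _; have [t ->] := qclass_surj C; have [a at_] := converges_exists t.
rewrite (canonical_injectionE at_); exists (cls a) => //.
exact/cauchy_classesP/(converges_stable at_).
Qed.

(** A stable sequence belongs to its own limit. *)
Lemma limit_asymptotic a b : stable b -> limit R (cls a) = limit R (cls b) ->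
  asymptotic a b.
Proof.
move=> sb e; suff /limitP[] : limit R (cls a) (cls b) by [].
rewrite e; apply/limitP; split=> // n; exists 0 => k _; exact: alpha_refl.
Qed.

Lemma canonical_injection_inj :
  set_inj [set: mterm_alpha V S] (canonical_injection R V S).
Proof.
move=> C D _ _; have [t ->] := qclass_surj C; have [u ->] := qclass_surj D.
have [a at_] := converges_exists t; have [b bu] := converges_exists u.
rewrite (canonical_injectionE at_) (canonical_injectionE bu) => e.
apply/mqclassP/(converges_asymptotic at_ bu)/limit_asymptotic => //.
exact: converges_stable bu.
Qed.

Lemma canonical_injection_surjP :
  set_surj [set: mterm_alpha V S] (completion R V S) (canonical_injection R V S)
  <-> forall a, stable a -> exists t b, converges b t /\ asymptotic a b.
Proof.
split=> [h a sa|h _ [s cs <-]].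
  have [|C _] := h (limit R (cls a)); first by exists (cls a) => //; apply/cauchy_classesP.
  have [t ->] := qclass_surj C; have [b bt] := converges_exists t.
  rewrite (canonical_injectionE bt) => e; exists t, b; split=> //.
  exact/asymptotic_sym/limit_asymptotic.
have [a ea] := cls_surj s; rewrite ea in cs *.
have [t [b [bt ab]]] := h a ((cauchy_classesP a).1 cs).
by exists (qclass _ t) => //; rewrite (canonical_injectionE bt) (eq_limit ab).
Qed.

(* Naming level k by [w k], for names [w] foreign to the whole sequence, turns
   truncations that are stable up to alpha into literally stable ones. *)
Lemma uncountable_surj : ~ countable [set: V] ->
  set_surj [set: mterm_alpha V S] (completion R V S) (canonical_injection R V S).
Proof.
move=> V_unc; apply/canonical_injection_surjP => a sa.
pose A := \bigcup_(k in [set: nat]) [set v | occurs v (a k)].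
have cA : countable A.
  apply: bigcup_countable => // k _; apply: finite_set_countable.
  exact: occurs_finite.
(* Each term has finitely many names, so [A] is countable; a finite complement would make [V]
   countable. *)
have : infinite_set (~` A).
  move=> /finite_set_countable cA'; apply: V_unc.
  exact: countable_setC cA'.
move=> /infinite_inj[w [wi wC]].
have wA k n : ~~ occurs (w n) (a k).
  by apply/negP => h; have := wC n; apply; exists k.
pose b k := relevel w 0 id (a k).
have ab k : alpha (a k) (b k).
  apply/alphaP => //; rewrite (@relevel_relevel _ _ _ _ w inr _ 0 id inl inl) // => v hv.
  by split=> // m _ e; have := wA k m; rewrite -e hv.
have [t bt] : exists t, converges b t.
  apply: mterm_complete => n; have [N hN] := sa n; exists N => k l Nk Nl.
  by rewrite !trunc_relevel; apply: alpha_relevel; apply: hN.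
exists t, b; split=> // n; exists 0 => k _; exact: alpha_talpha.
Qed.

End Completion.

(** * Countably many variables: a Cauchy sequence without a mixed limit *)

Lemma countable_enum (T : Type) : [set: T] !=set0 -> countable [set: T] ->
  exists v : nat -> T, forall x, exists j, v j = x.
Proof.
move=> [x0 _] /countable_injP[f fi].
(* Numbers that code no element are sent to [x0]. *)
have /choice[v hv] : forall n, exists x, forall y, f y = n -> x = y.
  move=> n; have [[x <-]|h] := pselect (exists x, f x = n).
    by exists x => y /fi e; apply/esym/e; rewrite in_setT.
  by exists x0 => y e; case: h; exists y.
by exists v => x; exists (f x); apply: hv.
Qed.

Lemma eq_trunc_node (V : choiceType) (S : mbs) n (c : S)
    (xs : forall i : 'I_(nargs c), (binds i).-tuple V)
    (ts us : 'I_(nargs c) -> term V S void) :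
  (forall i, trunc n (ts i) = trunc n (us i)) ->
  trunc n (Node xs ts) = trunc n (Node xs us).
Proof.
case: n => // n h /=; congr Node; apply/funext => i.
by apply: eq_trunc_le (h i) _; exact: leq_subr.
Qed.

Section AllVariables.
Variables (V : choiceType) (S : mbs) (v : nat -> V) (l m g : S).
Hypothesis v_surj : forall x, exists j, v j = x.
Hypothesis V_infinite : infinite_set [set: V].
Variables (il : 'I_(nargs l)) (ig : 'I_(nargs g)).
Hypotheses (il_binds : 0 < binds il) (ig_coind : coind ig) (m_binary : 1 < nargs m).

(** All binding positions carry one dummy name [x], which captures nothing when it differs from the
    variables below. *)
Definition cnode (c : S) (x : V) (ts : 'I_(nargs c) -> term V S void) :=
  Node (fun i => nseq_tuple (binds i) x) ts.

(* g (m (v_j, g (m (v_{j+1}, ...)))), with k nested occurrences of g. *)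
Fixpoint spine (x : V) j k : term V S void :=
  if k is k'.+1 then
    cnode (c := g) x (fun i =>
      if coind i then
        cnode (c := m) x (fun p => if p == 0 :> nat then Var (v j)
                                   else spine x j.+1 k')
      else Var (v 0))
  else Var (v 0).

(** For each [k] some dummy [x] avoids the variables of the spine, but as [k] grows every variable
    appears free under [l], which leaves no dummy for the limit. *)
Definition binder x k : term V S void := cnode (c := l) x (fun=> spine x 0 k).

Definition avoids x k := forall i, i <= k -> v i != x.

Lemma bind_nseq (W : choiceType) (w : nat -> W) q (r : V -> W) x n y :
  y != x -> bind w q (nseq n x) r y = r y.
Proof. by move=> yx; rewrite bind_notin // mem_nseq negb_and yx orbT. Qed.

(** Each [g] costs a unit of depth, so depth [n] is used up before either spine ends. *)
Lemma trunc_spine x n j k k' : n <= k -> n <= k' ->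
  trunc n (spine x j k) = trunc n (spine x j k').
Proof.
elim: n j k k' => [|n IH] j k k'; first by rewrite !trunc_at0.
case: k k' => [|k] [|k'] // nk nk'.
rewrite /spine -/spine /=; congr Node; apply/funext => i.
case: (coind i) => //; rewrite subn1; apply: eq_trunc_node => p.
by case: eqP => // _; apply: IH.
Qed.

(** The dummies [x] and [x'] capture no variable of the spine, and relevelling forgets the names of
    binders. *)
Lemma relevel_spine (W : choiceType) (w : nat -> W) q (r r' : V -> W) x x' j k :
  (forall i, i <= j + k -> r (v i) = r' (v i)) ->
  avoids x (j + k) -> avoids x' (j + k) ->
  relevel w q r (spine x j k) = relevel w q r' (spine x' j k).
Proof.
elim: k j q r r' => [|k IH] j q r r' h a a' /=; first by rewrite h.
have b n n' q' q'' i : i <= j + k.+1 ->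
    bind w q' (nseq n x) (bind w q'' (nseq n' x) r) (v i) =
    bind w q' (nseq n x') (bind w q'' (nseq n' x') r') (v i).
  by move=> ij; rewrite !bind_nseq ?a ?a' ?h.
congr Node; apply/funext => i; case: (coind i) => /=; last first.
  by rewrite !bind_nseq ?a ?a' ?h.
congr Node; apply/funext => p; case: eqP => _ /=.
  by rewrite b // leq_addr.
by apply: IH; rewrite addSnnS // => i'; apply: b.
Qed.

Lemma occurs_cnode (W : choiceType) (w : nat -> W) q (r : V -> W) c x
    (ts : 'I_(nargs c) -> term V S void) n i y :
  occurs y (relevel w (q + binds i) (bind w q (nseq (binds i) x) r)
                    (trunc (n.+1 - coind i) (ts i))) ->
  occurs y (relevel w q r (trunc n.+1 (cnode x ts))).
Proof. by move=> h; apply: occurs_arg; exact: h. Qed.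

(** A layer costs one unit of depth for [g] and at most one for [m]; with [d] layers above that of
    [v (j + d)] and a positive depth left for the variable itself, [2d + 3] suffices. *)
Lemma occurs_spine (W : choiceType) (w : nat -> W) q (r : V -> W) x n j d k :
  d < k -> d.*2.+2 < n -> avoids x (j + d) ->
  occurs (r (v (j + d))) (relevel w q r (trunc n (spine x j k))).
Proof.
elim: d n j k q r => [|d IH] [|[|n]] j [|k] q r // dk dn a;
  apply: (occurs_cnode (i := ig)); rewrite ig_coind subn1.
(* Position 0 of [m] holds the variable of the layer, position 1 the rest of the spine. *)
- apply: (occurs_cnode (i := Ordinal (ltnW m_binary))).
  rewrite /= addn0; case: (coind _); case: n dn => [//|n] _ /=;
    by rewrite !bind_nseq // a ?addn0.
- apply: (occurs_cnode (i := Ordinal m_binary)).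
  rewrite -[X in trunc _ X]/(spine x j.+1 k) addnS -addSn.
  set q' := (X in relevel w X); set r' := (X in relevel w _ X).
  have <- : r' (v (j.+1 + d)) = r (v (j.+1 + d)).
    by rewrite /r' !bind_nseq // a // addSnnS.
  apply: IH => //; last by rewrite addSnnS.
  by move: dn; rewrite doubleS; case: (coind _); rewrite ?subn0 ?subn1 //= => /ltnW.
Qed.

Lemma exists_avoids k : exists x, avoids x k.
Proof.
have [x hx] := exists_notin V_infinite (finite_seq [seq v i | i <- iota 0 k.+1]).
exists x => i ik; apply/eqP => e; apply: hx; rewrite -e /=.
by apply: (@map_f _ _ v (iota 0 k.+1)); rewrite mem_iota.
Qed.

(** At depth [n] only the first [n] layers count, and there the two dummies are interchangeable up
    to alpha. *)
Lemma stable_binder (x : nat -> V) : (forall k, avoids (x k) k) ->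
  stable (fun k => binder (x k) k).
Proof.
move=> hx n; exists n.
have tr k : n <= k -> trunc n (binder (x k) k) = trunc n (binder (x k) n).
  by move=> nk; apply: eq_trunc_node => i; apply: trunc_spine.
move=> k j nk nj; rewrite /talpha !tr //; apply: alpha_talpha => //.
apply/alphaP => //=; congr Node; apply/funext => i.
by apply: relevel_spine => i' ni; rewrite ?bind_nseq ?hx // (leq_trans ni).
Qed.

(* A bound name of the head binder of a limit would be some [v j], which occurs
   free below that binder in almost all approximations. *)
Lemma binder_no_limit (x : nat -> V) (t : mterm V S) b :
  (forall k, avoids (x k) k) ->
  converges b t -> ~ asymptotic (fun k => binder (x k) k) b.
Proof.
move=> hx bt co.
have lim n M : exists2 k, M <= k & alpha (trunc n (binder (x k) k)) (mtrunc n t).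
  have [N hN] := co n; have [N' hN'] := bt n.
  exists (maxn M (maxn N N')); first exact: leq_maxl.
  rewrite -(hN' (maxn M (maxn N N'))); last by rewrite !leq_max leqnn !orbT.
  by apply: hN; rewrite !leq_max leqnn !orbT.
have {lim} lim n M : exists2 k, M <= k &
    relevel (W := (V + nat)%type) inr 0 inl (trunc n (binder (x k) k)) =
    relevel inr 0 inl (mtrunc n t).
  by have [k Mk /(alphaP V_infinite)] := lim n M; exists k.
have mt n := mtruncP n t.
case: (mtree t) mt => [y|c ys ts] mt.
  have [k _] := lim 1 0; by have := mt 1; inversion 1.
have {mt} mt n : exists us, mtrunc n.+1 t = Node ys us.
  by have [us [-> _]] := truncates_TNode (mt n.+1); exists us.
have ? : l = c.
  by have [us e] := mt 0; have [k _] := lim 1 0; rewrite e; case.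
subst c.
have [y yin] : exists y, y \in ys il.
  by exists (tnth (ys il) (Ordinal il_binds)); exact: mem_tnth.
have [j vj] := v_surj y.
(* Depth [2j + 4] leaves at least [2j + 3] below [l], enough to reach [v j], and [k > j] ensures
   that the spine has this layer. *)
have [us e] := mt j.*2.+3; have [k jk] := lim j.*2.+4 j.+1.
rewrite e => /Node_inj[_ /(congr1 (fun f => f il)) e'].
pose r := bind inr 0 (nseq (binds il) (x k)) (@inl V nat).
have {e'} : relevel inr (0 + binds il) r (trunc (j.*2.+4 - coind il) (spine (x k) 0 k)) =
    relevel inr (0 + binds il) (bind inr 0 (ys il) inl) (us il) := e'.
have ax : avoids (x k) j by move=> i ij; apply: hx; apply: leq_trans ij (ltnW jk).
have dj : j.*2.+2 < j.*2.+4 - coind il by case: (coind il).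
move=> e'; have := occurs_spine (j := 0) inr (0 + binds il) r jk dj ax.
rewrite {}e' add0n /r bind_nseq ?ax // vj.
(* On the side of the limit [y] is bound by [ys il] and becomes a level, so no name is sent to
   [inl y]. *)
case/(occurs_relevel (f := inl)) => //.
move=> z; have [zin|zin] := boolP (z \in ys il).
  by have [i ->] := bind_range inr 0 inl zin.
by rewrite bind_notin // => -[zy]; rewrite zy yin in zin.
Qed.

End AllVariables.

Theorem theorem1p14 (R : realType) (V : choiceType) (S : mbs)
    (V_infinite : infinite_set [set: V])
    (S_nontrivial : nontrivial_mbs S) :
  [/\ set_fun [set: mterm_alpha V S] (completion R V S) (canonical_injection R V S),
      set_inj [set: mterm_alpha V S] (canonical_injection R V S)
    & set_bij [set: mterm_alpha V S] (completion R V S) (canonical_injection R V S)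
      <-> ~ countable [set: V]].
Proof.
have fn := canonical_injection_fun R (S := S) V_infinite.
have ij := canonical_injection_inj (R := R) (S := S) V_infinite.
split=> //; split=> [[_ _ /(canonical_injection_surjP R S V_infinite) surj] cV|unc].
  have [[l [il bl]] [m hm] [g [ig cg]]] := S_nontrivial.
  have [|v vs] := countable_enum _ cV.
    by have [x _] := exists_notin V_infinite (finite_set0 V); exists x.
  have [x hx] := choice (exists_avoids v V_infinite).
  have [t [b [bt]]] := surj _ (stable_binder l m g V_infinite hx).
  exact: (binder_no_limit vs V_infinite bl cg hm hx bt).
by split=> //; exact: uncountable_surj.
Qed.
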